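(* Let $G$ be a finite simple connected planar graph with a fixed planar embedding, let $G^*$ be its dual, and consider the pure coordination game on $G$ with strategy set $C=\{1,\dots,m\}$, $m\ge |V(G)|$. If $s\in\mathcal{SC}_{G^*}$ satisfies \[ \mathrm{size}(s)\le \mathrm{size}(r)\qquad\text{for all } r\in\Gamma_{\mathcal{SC}}(s):=\{t\in\mathcal{SC}_{G^*}: d_{\mathcal{SC}}(s,t)\le 1\}, \] then there is a $u\in\mathcal{A}_G$ with $\Psi(\Phi u)=s$ such that $u$ is a Nash equilibrium. Moreover, this $u$ satisfies $\Phi u\in\mathcal{QC}_G$, so that $u$ is the unique element of $\mathcal{A}_G$ with $\Phi u\in\mathcal{QC}_G$ and $\Psi(\Phi u)=s$.
   Context: Game. $G=(V,E)$ is a graph with adjacency matrix $W$. A strategy profile is a map $u:V\to C$. The payoff to player $v$ for playing $i\in C$ against $u$ is $w_v(i|u)=\sum_{x\in V}W_{v,x}\,\delta(i,u_x)$, where $\delta$ is the Kronecker delta. A profile $u$ is a Nash equilibrium if $w_v(u_v|u)\ge w_v(i|u)$ for all $v\in V$, $i\in C$. Partitions. $\mathcal{Q}_G$ is the set of partitions of $V$ into nonempty parts. $\Phi$ sends a profile $u$ to the partition in which two vertices are in the same part iff they use the same strategy in $u$. $\mathcal{A}_G$ is the set of equivalence classes of profiles under ''same image under $\Phi$''; $\Phi:\mathcal{A}_G\to\mathcal{Q}_G$ is then a bijection (since $m\ge|V|$). A class in $\mathcal{A}_G$ is called a Nash equilibrium if one (equivalently every) profile in it is. $\mathcal{QC}_G\subseteq\mathcal{Q}_G$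 is the set of partitions each of whose parts induces a connected subgraph of $G$. Dual. $G^*$ is the planar dual (possibly a multigraph) of the embedded graph $G$; edges $e$ of $G$ correspond bijectively to edges $e^*$ of $G^*$, and vertices of $G$ correspond bijectively to faces of $G^*$. $\Psi$ sends a partition $P$ of $V$ to the subgraph of $G^*$ spanned by the edges $e^*$ for which $e$ is in the cutset of $P$ (i.e. $e$ joins two different parts of $P$). Subgraph space. Subgraphs of $G^*$ are taken to be spanned by their edges (no isolated vertices), so they are identified with edge sets. $\mathcal{SC}_{G^*}$ is the set of subgraphs of $G^*$ having no bridge (the empty subgraph included), and $\mathrm{size}(s)$ is the number of edges of $s$. For a face $f$ of $G^*$ and $s\in\mathcal{SC}_{G^*}$, a vertex $a$ of $G^*$ on the boundary of $f$ is a departure vertex of $f$ if $s$ contains $a$ and at least one edge at $a$ that is not incident to the face $f$. For $s,r\in\mathcal{SC}_{G^*}$, $r$ is obtained from $s$ by a single face rewiring (SFR) if there is a face $f$ of $G^*$ such that: (1) Locality: every edge not incident to $f$ is in $s$ iff it is in $r$; (2) Closure: the edges incident to $f$ are added or removed in such a way that no bridge is created in $r$; (3) Connectivity: if two departure vertices of $f$ are connected by a path in $s$ along $f$ (i.e. using only edges incident to $f$) but are not connected by a path in $r$ along $f$, then they lie in different connected components of $r$ (there is no path in $r$ between them). $d_{\mathcal{SC}}(s,t)$ is the minimum number of successive SFRs needed to go from $s$ to $t$ (a quasimetric, not necessarily symmetric); so $d_{\mathcal{SC}}(s,t)\le 1$ iff $t=s$ or $t$ is obtained from $s$ by one SFR.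 *)

(* Defs.v *)
From HB Require Import structures.
From mathcomp Require Import all_fingroup all_boot.

Set Implicit Arguments.
Unset Strict Implicit.
Unset Printing Implicit Defensive.

(** * Simple graphs *)

Record sgraph := SGraph {
  vertex :> finType;
  adj : rel vertex;
  adj_sym : symmetric adj;
  adj_irr : irreflexive adj
}.

Section Graph.
Variable G : sgraph.

Definition connected_graph := forall x y : G, connect (@adj G) x y.

(* [A] induces a connected subgraph *)
Definition connected_in (A : {set G}) : bool :=
  [forall x in A, forall y in A,
     connect [rel a b | [&& a \in A, b \in A & adj a b]] x y].

(* An edge is the 2-set of its ends; a dart is an edge with an orientation. *)
Definition edge := {e : {set G} |
  [exists x : G, exists y : G, adj x y && (e == [set x; y])]}.

Definition dart := {p : G * G | adj p.1 p.2}.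

Definition src (d : dart) : G := (val d).1.
Definition tgt (d : dart) : G := (val d).2.

Lemma rev_subproof (d : dart) : adj (tgt d) (src d).
Proof. by case: d => [[x y] xy]; rewrite adj_sym. Qed.

Definition rev (d : dart) : dart :=
  exist (fun p : G * G => adj p.1 p.2) (tgt d, src d) (rev_subproof d).

Lemma revK : involutive rev.
Proof. by case=> [[x y] xy]; apply: val_inj. Qed.

Definition rev_perm : {perm dart} := perm (can_inj revK).

Lemma edge_of_subproof (d : dart) :
  [exists x : G, exists y : G,
     adj x y && ([set src d; tgt d] == [set x; y])].
Proof.
apply/existsP; exists (src d); apply/existsP; exists (tgt d).
by rewrite eqxx andbT; case: d => [[x y] xy].
Qed.

Definition edge_of (d : dart) : edge :=
  exist (fun e : {set G} =>
    [exists x : G, exists y : G, adj x y && (e == [set x; y])])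
    [set src d; tgt d] (edge_of_subproof d).

(** * Embeddings and their faces *)

(* [rot] sends a dart [d] to the next dart, in cyclic order, around [src d];
   the boundary walks of the faces are then the orbits of [rot \o rev]. *)
Definition face_perm (rot : {perm dart}) : {perm dart} := (rev_perm * rot)%g.

(* If [G] has no edge, the sphere minus [G] is still one face, but no dart
   lies on it. *)
Definition faces (rot : {perm dart}) : {set {set dart}} :=
  if #|{: dart}| == 0 then [set set0] else porbits (face_perm rot).

(* An embedding of a connected graph in the sphere (or the plane), up to
   homeomorphism, is a rotation system (a cyclic order of the darts around each
   vertex) satisfying Euler's formula. The record is meant to be used with
   [connected_graph]. *)
Record plane_embedding := PlaneEmbedding {
  rot : {perm dart};
  rotP : forall d d' : dart, (d' \in porbit rot d) = (src d' == src d);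
  euler : #|G| + #|faces rot| = #|{: edge}| + 2
}.

End Graph.

(** * The dual multigraph

   The vertices of the dual are the faces of the embedded graph, its edges are
   identified with [edge G] and its faces with [vertex G]. *)

Section Dual.
Variables (G : sgraph) (emb : plane_embedding G).

Definition dual_vertex := {F : {set dart G} | F \in faces (rot emb)}.

Lemma face_of_subproof (d : dart G) :
  porbit (face_perm (rot emb)) d \in faces (rot emb).
Proof.
rewrite /faces -[_ == 0]negbK -lt0n; have -> /= : 0 < #|{: dart G}|.
  by apply/card_gt0P; exists d.
exact: imset_f.
Qed.

Definition face_of (d : dart G) : dual_vertex :=
  exist (fun F : {set dart G} => F \in faces (rot emb))
    (porbit (face_perm (rot emb)) d) (face_of_subproof d).

(* the ends of the dual edge e*: one face if e* is a loop, else two *)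
Definition dual_ends (e : edge G) : {set dual_vertex} :=
  [set face_of d | d : dart G & edge_of d == e].

Definition on_dual_face (f : G) (e : edge G) : bool := f \in val e.

Definition vertex_on_dual_face (f : G) (a : dual_vertex) : bool :=
  [exists d : dart G, (src d == f) && (face_of d == a)].

(* Subgraphs of the dual are spanned by their edges. *)
Definition subgraph := {set edge G}.

Definition dual_adj (s : subgraph) : rel dual_vertex :=
  [rel a b | [exists e in s, dual_ends e == [set a; b]]].

Definition dual_connected (s : subgraph) : rel dual_vertex :=
  connect (dual_adj s).

(* an edge of [s] that separates its ends; a loop is never a bridge *)
Definition bridge (s : subgraph) (e : edge G) : bool :=
  (e \in s) &&
  [exists a, exists b, (dual_ends e == [set a; b]) &&
                       ~~ dual_connected (s :\ e) a b].

Definition SC : {set subgraph} := [set s | [forall e, ~~ bridge s e]].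

Definition size_sg (s : subgraph) : nat := #|s|.

(** * Single face rewirings *)

Definition departure (s : subgraph) (f : G) (a : dual_vertex) : bool :=
  vertex_on_dual_face f a &&
  [exists e in s, (a \in dual_ends e) && ~~ on_dual_face f e].

Definition connected_along (f : G) (s : subgraph) : rel dual_vertex :=
  dual_connected [set e in s | on_dual_face f e].

Definition sfr_locality (f : G) (s r : subgraph) : bool :=
  [forall e, ~~ on_dual_face f e ==> ((e \in s) == (e \in r))].

(* Under locality, [departure s f] and [departure r f] coincide. *)
Definition sfr_connectivity (f : G) (s r : subgraph) : bool :=
  [forall a, forall b,
     [&& departure s f a, departure s f b,
         connected_along f s a b & ~~ connected_along f r a b]
     ==> ~~ dual_connected r a b].

(* The closure condition is [r \in SC]. *)
Definition SFR : rel subgraph :=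
  [rel s r | [&& s \in SC, r \in SC &
     [exists f : G, sfr_locality f s r && sfr_connectivity f s r]]].

(* The least length of a chain of SFRs from [s] to [t]. If there is no such
   chain the value is the number of all subgraphs, which exceeds the length of
   every shortest chain. *)
Definition dSC (s t : subgraph) : nat :=
  find (fun k => [exists p : k.-tuple subgraph,
                    path SFR s p && (last s p == t)])
       (iota 0 #|{: subgraph}|).

Lemma dSC_path_le (s t : subgraph) (p : seq subgraph) :
  path SFR s p -> last s p = t -> dSC s t <= size p.
Proof.
move=> sp lp; have [ltk|] := ltnP (size p) #|{: subgraph}|; last first.
  by apply: leq_trans; rewrite -[leqRHS](size_iota 0) find_size.
rewrite leqNgt; apply/negP => /(before_find 0); rewrite nth_iota // add0n.
by move/negbT/existsPn/(_ (in_tuple p)); rewrite sp lp eqxx.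
Qed.

Lemma dSC_path (s t : subgraph) :
  connect SFR s t -> exists2 p, path SFR s p & last s p = t /\ size p = dSC s t.
Proof.
case/connectP => p0 sp0 ->; case/shortenP: sp0 => p sp up _ {p0}.
have szp : size p < #|{: subgraph}|.
  by rewrite -[_.+1]/(size (s :: p)) -(card_uniqP up) max_card.
have ltd : dSC s (last s p) < #|{: subgraph}|.
  by apply: leq_ltn_trans szp; apply: dSC_path_le.
have := ltd; rewrite -[X in _ < X](size_iota 0) -has_find.
move/(nth_find 0); rewrite -/(dSC _ _) nth_iota // add0n.
case/existsP=> q /andP[sq /eqP lq]; exists q => //.
by rewrite size_tuple.
Qed.

Lemma dSC_unreachable (s t : subgraph) :
  ~~ connect SFR s t -> dSC s t = #|{: subgraph}|.
Proof.
move=> nst; rewrite /dSC hasNfind ?size_iota //.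
apply/hasPn => k _; apply/negP => /existsP[p /andP[sp /eqP lp]].
by case/connectP: nst; exists p.
Qed.

(* the closed unit ball around [s] *)
Definition GammaSC (s : subgraph) : {set subgraph} :=
  [set t in SC | dSC s t <= 1].

Lemma in_GammaSC (s t : subgraph) : s \in SC ->
  (t \in GammaSC s) = (t == s) || SFR s t.
Proof.
move=> sSC; rewrite inE; apply/andP/orP => [[tSC]|[/eqP->|st]].
- have [cst|nst] := boolP (connect SFR s t).
    have [p sp [lp <-]] := dSC_path cst.
    case: p sp lp => [|r [|//]] /= sp <- _; first by left.
    by right; case/andP: sp.
  rewrite (dSC_unreachable nst) => le1; left; apply/eqP.
  by apply: (card_le1_eqP le1).
- by split=> //; apply: leq_trans (@dSC_path_le s s [::] isT erefl) _.
- split; first by case/and3P: st.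
  by apply: (@dSC_path_le s t [:: t]); rewrite //= st.
Qed.

End Dual.

(** * The pure coordination game *)

Section Game.
Variables (G : sgraph) (m : nat).

Definition strategy := 'I_m.
Definition profile := {ffun G -> strategy}.

(* the adjacency matrix *)
Definition W (v x : G) : nat := adj v x.

Definition payoff (u : profile) (v : G) (i : strategy) : nat :=
  \sum_(x : G) W v x * (i == u x).

Definition nash (u : profile) : bool :=
  [forall v, forall i, payoff u v i <= payoff u v (u v)].

Definition QG : {set {set {set G}}} := [set P | partition P [set: G]].

Definition QC : {set {set {set G}}} :=
  [set P in QG | [forall A in P, connected_in A]].

Definition Phi_profile (u : profile) : {set {set G}} :=
  preim_partition u [set: G].

Definition same_Phi : rel profile :=
  [rel u v | Phi_profile u == Phi_profile v].

Lemma same_Phi_refl : reflexive same_Phi.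
Proof. by move=> u; apply: eqxx. Qed.

Lemma same_Phi_sym : symmetric same_Phi.
Proof. by move=> u v; apply: eq_sym. Qed.

Lemma same_Phi_trans : transitive same_Phi.
Proof. by move=> v u w; rewrite /same_Phi /= => /eqP-> /eqP->. Qed.

Canonical same_Phi_equiv :=
  EquivRel same_Phi same_Phi_refl same_Phi_sym same_Phi_trans.

(* the set A_G of classes of profiles with the same partition *)
Definition profile_class := {eq_quot same_Phi_equiv}%qT.

Definition Phi (a : profile_class) : {set {set G}} := Phi_profile (repr a).

Definition nash_class (a : profile_class) : bool :=
  [exists u : profile, (\pi_profile_class u == a :> profile_class)%qT && nash u].

Lemma Phi_pi (u : profile) :
  Phi (\pi_profile_class u)%qT = Phi_profile u.
Proof.
have /eqmodP /eqP // :
  (repr (\pi_profile_class u) = u %[mod profile_class])%qT by rewrite reprK.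
Qed.

Lemma Phi_inj : injective Phi.
Proof.
move=> a b ab; rewrite -[a]reprK -[b]reprK.
by apply/eqmodP/eqP.
Qed.

Lemma Phi_QG (a : profile_class) : Phi a \in QG.
Proof. by rewrite inE preim_partitionP. Qed.

Lemma Phi_profileE (u v : profile) :
  Phi_profile u = Phi_profile v -> forall x y, (u x == u y) = (v x == v y).
Proof.
move=> uv x y.
have R (w : profile) : (w x == w y) = (y \in pblock (Phi_profile w) x).
  rewrite /Phi_profile /preim_partition pblock_equivalence_partition ?inE //.
  by split=> //= /eqP->.
by rewrite !R uv.
Qed.

Lemma nash_same_Phi (u v : profile) :
  Phi_profile u = Phi_profile v -> nash u -> nash v.
Proof.
move=> uv /forallP nu; have E := Phi_profileE uv.
apply/forallP=> x; apply/forallP=> i.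
have own y : payoff u x (u y) = payoff v x (v y).
  by apply: eq_bigr => z _; rewrite E.
have [/existsP[y /eqP <-]|/existsPn no] := boolP [exists y, v y == i].
  by rewrite -!own; exact: (forallP (nu x)).
rewrite /payoff big1 // => y _.
by rewrite eq_sym (negPf (no y)) muln0.
Qed.

Lemma nash_class_pi (u : profile) :
  nash_class (\pi_profile_class u)%qT = nash u.
Proof.
apply/existsP/idP => [[v /andP[/eqP/eqmodP/eqP vu nv]]|nu].
  exact: nash_same_Phi vu nv.
by exists u; rewrite eqxx.
Qed.

(* [m >= |V|] is what makes [Phi] onto. *)
Lemma Phi_surj (P : {set {set G}}) :
  #|G| <= m -> P \in QG -> exists a, Phi a = P.
Proof.
rewrite inE => Gm partP; have [/eqP cP tP _] := and3P partP.
pose c (x : G) : G := odflt x [pick y in pblock P x].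
have inP x : x \in cover P by rewrite cP inE.
have cin x : c x \in pblock P x.
  by rewrite /c; case: pickP => [y //|/(_ x)]; rewrite mem_pblock inP.
have cE x y : (c x == c y) = (y \in pblock P x).
  rewrite -eq_pblock //; apply/eqP/eqP => [cxy|pxy].
    by rewrite -(same_pblock tP (cin x)) cxy (same_pblock tP (cin y)).
  rewrite /c pxy; case: pickP => //= /(_ y).
  by rewrite mem_pblock inP.
pose u : profile := [ffun x => widen_ord Gm (enum_rank (c x))].
exists (\pi_profile_class u)%qT; rewrite Phi_pi.
rewrite -[RHS](equivalence_partition_pblock partP).
apply: eq_in_imset => x _; apply/setP=> y; rewrite !inE /= !ffunE.
by rewrite -val_eqE /= val_eqE (inj_eq enum_rank_inj) cE.
Qed.

End Game.

(* [Psi P] is the dual subgraph spanned by the duals of the cutset of [P]. *)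
Definition Psi (G : sgraph) (P : {set {set G}}) : subgraph G :=
  [set e : edge G | [exists x in val e, exists y in val e,
                       pblock P x != pblock P y]].

(* Main.v *)
Require Import Defs.
From mathcomp Require Import all_fingroup all_boot zify.

Set Implicit Arguments.
Unset Strict Implicit.
Unset Printing Implicit Defensive.

(** Planar duality is used in this form: for an edge [e] outside a dual subgraph
    [r], the ends of [e*] are connected in [r] iff the ends of [e] are not
    connected in [G - r - e]. Applied to [s - e] it makes a bridgeless [s] the
    cutset of the partition into components of [G - s]. If that partition were
    not Nash, moving one vertex [v] to a better strategy [i] would give a
    smaller cutset [r], which is bridgeless by duality again. It is an SFR of
    [s]: the part [i] is connected in [G - v], so two edges from [v] into it lie
    on a cycle avoiding [r], and corners of [v] separated by these two edges are
    not connected in [r]. *)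

Local Notation rev := Defs.rev.
Local Notation rot := Defs.rot.

(** * Counting connected components by canonical representatives *)

Section Components.
Variable T : finType.
Implicit Types (e : rel T) (x y z w : T).

Lemma connect_homo e (P : T -> Prop) x y :
  (forall z w, e z w -> P z -> P w) -> connect e x y -> P x -> P y.
Proof.
move=> eP /connectP[p]; elim: p x => [|z p IHp] x /= => [_ ->//|].
by case/andP=> /eP xz /IHp{}IHp /IHp{}IHp /xz.
Qed.

(** An added edge can only merge the classes of [x] and [y]; following a path step by step, only its
    net crossing of that edge is recorded. *)
Lemma connect_add_edge e e' x y :
    symmetric e ->
    (forall z w, e' z w ->
       [\/ connect e z w, z = x /\ w = y | z = y /\ w = x]) ->
  forall z w, connect e' z w ->
  [\/ connect e z w, connect e z x /\ connect e y w
    | connect e z y /\ connect e x w].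
Proof.
move=> /sym_connect_sym e_sym e'e z w zw.
pose P w := [\/ connect e z w, connect e z x /\ connect e y w
               | connect e z y /\ connect e x w].
apply: (connect_homo (P := P) _ zw); last by constructor 1.
move=> {zw} {}w t /e'e[wt|[-> ->]|[-> ->]].
- by case=> [zw|[zx yw]|[zy xw]]; [constructor 1|constructor 2|constructor 3];
    rewrite ?(connect_trans _ wt).
- case=> [zx|[zx _]|[zy _]]; [constructor 2|constructor 2|constructor 1] => //.
- case=> [zx|[zx _]|[zy _]]; [constructor 3|constructor 1|constructor 3] => //.
Qed.

(** [root e'] is injective on the roots of [e], once the root of [y] is set aside in case [e] does
    not connect [x] and [y]. *)
Lemma roots_add_edge e e' x y :
    symmetric e -> symmetric e' ->
    (forall z w, e' z w ->
       [\/ connect e z w, z = x /\ w = y | z = y /\ w = x]) ->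
  #|roots e| <= #|roots e'| + ~~ connect e x y.
Proof.
move=> se se' e'e; have ce := sym_connect_sym se.
have ce' := sym_connect_sym se'.
have add := connect_add_edge se e'e.
pose A := [predD1 roots e & root e y].
have card (B : {pred T}) : {in B &, injective (root e')} -> #|B| <= #|roots e'|.
  move/card_in_image <-; apply/subset_leq_card/subsetP => _ /imageP[z _ ->].
  exact: roots_root.
have inj z w : z \in roots e -> w \in roots e -> connect e z w -> z = w.
  by move=> /eqP rz /eqP rw /(rootP ce); rewrite rz rw.
have [xy|nxy] := boolP (connect e x y).
  rewrite addn0; apply: card => z w rz rw /(rootP ce')/add zw; apply: inj => //.
  case: zw => // [[zx yw]|[zy xw]].
    exact: connect_trans zx (connect_trans xy yw).
  by apply: connect_trans zy (connect_trans _ xw); rewrite ce.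
rewrite (cardD1 (root e y)) addnC leq_add //; last exact: leq_b1.
apply: card => z w; rewrite !inE.
move=> /andP[zy rz] /andP[wy rw] /(rootP ce')/add zw.
have ne t : t != root e y -> t \in roots e -> ~ connect e t y.
  by move=> ty rt /(rootP ce) ety; rewrite -ety (eqP rt) eqxx in ty.
apply: inj => //; case: zw => // [[_ yw]|[zy' _]].
  by case: (ne _ wy rw); rewrite ce.
by case: (ne _ zy rz).
Qed.

Lemma card_roots_connected e :
  (forall x y, connect e x y) -> #|roots e| <= 1.
Proof.
move=> conn; apply/card_le1_eqP => x y /eqP rx /eqP ry.
by rewrite -rx -ry; apply/rootP=> // z w; rewrite !conn.
Qed.

Lemma card_roots_discrete e : (forall x y, e x y = false) -> #|roots e| = #|T|.
Proof.
move=> no_e; apply: eq_card => x; rewrite !inE; apply/eqP/esym.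
apply: (connect_homo (P := eq x) _ (connect_root e x)) => // y z.
by rewrite no_e.
Qed.

Lemma cardsD_exchange (A r s : {set T}) :
  r :\: A = s :\: A -> #|r| + #|A :\: r| = #|s| + #|A :\: s|.
Proof.
move=> rs; rewrite -(cardsID A r) -(cardsID A s) rs ![_ :&: A]setIC.
by have := cardsID r A; have := cardsID s A; lia.
Qed.

End Components.

(** * Darts as oriented edges, and the graph [G - s] *)

Section Darts.
Variable G : sgraph.
Implicit Types (d : dart G) (e : edge G) (s : subgraph G).

Lemma src_neq_tgt d : src d != tgt d.
Proof.
case: d => [[x y] /= xy]; apply/eqP; rewrite /src /tgt /= => exy.
by rewrite exy adj_irr in xy.
Qed.

Lemma dart_inj d d' : src d = src d' -> tgt d = tgt d' -> d = d'.
Proof.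
by case: d d' => [[x y] xy] [[z w] zw]; rewrite /src /tgt /= => xz yw;
  apply: val_inj; rewrite /= xz yw.
Qed.

Lemma edge_of_rev d : edge_of (rev d) = edge_of d.
Proof. by apply: val_inj; rewrite /= setUC. Qed.

Lemma edge_of_surj e : exists d, e = edge_of d.
Proof.
case: e => A eA; have /existsP[x /existsP[y /andP[xy /eqP defA]]] := eA.
by exists (exist _ (x, y) xy); apply: val_inj.
Qed.

Lemma in_edge_of v d : (v \in val (edge_of d)) = (v == src d) || (v == tgt d).
Proof. by rewrite /= !inE. Qed.

Lemma edge_of_eq d d' : edge_of d = edge_of d' -> d' = d \/ d' = rev d.
Proof.
move=> dd'; have := src_neq_tgt d'.
have := in_edge_of (src d') d; have := in_edge_of (tgt d') d.
rewrite dd' !in_edge_of !eqxx orbT.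
move=> /esym/orP[] /eqP t /esym/orP[] /eqP s; rewrite s t ?eqxx // => _.
  by right; apply: dart_inj.
by left; apply: dart_inj.
Qed.

Lemma edge_of_src_inj d d' :
  edge_of d = edge_of d' -> src d' = src d -> d' = d.
Proof.
case/edge_of_eq=> // -> /eqP; rewrite [src _]/(tgt d) eq_sym.
by rewrite (negPf (src_neq_tgt d)).
Qed.

Definition deleted_adj s : rel G :=
  [rel x y | [exists d : dart G,
     [&& src d == x, tgt d == y & edge_of d \notin s]]].

Lemma deleted_adjP s x y :
  reflect (exists d, [/\ src d = x, tgt d = y & edge_of d \notin s])
          (deleted_adj s x y).
Proof.
apply: (iffP existsP) => -[d]; first by case/and3P=> /eqP ? /eqP ?; exists d.
by case=> <- <- ds; exists d; rewrite !eqxx.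
Qed.

Lemma deleted_adj_sym s : symmetric (deleted_adj s).
Proof.
by move=> x y; apply/deleted_adjP/deleted_adjP => -[d [<- <- ds]];
  exists (rev d); rewrite edge_of_rev.
Qed.

Lemma deleted_connectC s : connect_sym (deleted_adj s).
Proof. exact/sym_connect_sym/deleted_adj_sym. Qed.

Lemma deleted_connect_sub s s' x y :
  s' \subset s -> connect (deleted_adj s) x y -> connect (deleted_adj s') x y.
Proof.
move=> /subsetP s's; apply: connect_sub => {}x {}y /deleted_adjP[d [<- <- ds]].
by apply/connect1/deleted_adjP; exists d; split=> //; apply: contra ds => /s's.
Qed.

End Darts.

(** * The dual multigraph in terms of darts *)

Section Dual.
Variables (G : sgraph) (emb : plane_embedding G).
Implicit Types (d : dart G) (e : edge G) (s r : subgraph G).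
Local Notation face := (face_of emb).
Local Notation dadj s := (@dual_adj G emb s).
Local Notation dconn s := (@dual_connected G emb s).

Lemma src_face_perm d : src (face_perm (rot emb) d) = tgt d.
Proof.
rewrite /face_perm permM permE; apply/eqP; rewrite -[tgt d]/(src (rev d)).
by rewrite -(rotP emb) (mem_porbit _ 1).
Qed.

Lemma face_of_face_perm d : face (face_perm (rot emb) d) = face d.
Proof. by apply: val_inj; rewrite /= (porbit_perm _ 1). Qed.

Lemma face_of_rot d : face (rot emb d) = face (rev d).
Proof.
rewrite -(face_of_face_perm (rev d)); congr face_of.
by rewrite /face_perm permM permE Defs.revK.
Qed.

Lemma dual_ends_edge_of d :
  dual_ends emb (edge_of d) = [set face d; face (rev d)].
Proof.
apply/setP=> a; rewrite !inE; apply/imsetP/orP.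
  by case=> d'; rewrite inE => /eqP/esym/edge_of_eq[]-> ->; [left|right].
by case=> /eqP->; [exists d|exists (rev d)]; rewrite ?inE ?edge_of_rev.
Qed.

Lemma dual_adjP s a b :
  reflect (exists d, [/\ face d = a, face (rev d) = b & edge_of d \in s])
          (dual_adj s a b).
Proof.
apply: (iffP existsP) => [[e /andP[es]]|[d [<- <- ds]]]; last first.
  by exists (edge_of d); rewrite ds dual_ends_edge_of eqxx.
have [d ed] := edge_of_surj e; rewrite ed in es *.
rewrite dual_ends_edge_of => /eqP E.
have /set2P Ea : a \in [set face d; face (rev d)] by rewrite E set21.
have /set2P Eb : b \in [set face d; face (rev d)] by rewrite E set22.
have /set2P Ed : face d \in [set a; b] by rewrite -E set21.
have /set2P Erd : face (rev d) \in [set a; b] by rewrite -E set22.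
(* The ends are unordered, so the dart may have to be reversed; for a loop both choices agree. *)
suff: face d = a /\ face (rev d) = b \/ face d = b /\ face (rev d) = a.
  case=> -[da rdb]; first by exists d.
  by exists (rev d); rewrite edge_of_rev Defs.revK.
case: Ea Eb Ed Erd => -> [] -> [] ed1 [] ed2; rewrite -?ed1 -?ed2; auto.
Qed.

Lemma dual_adj_sym s : symmetric (dadj s).
Proof.
by move=> a b; apply/dual_adjP/dual_adjP => -[d [<- <- ds]];
  exists (rev d); rewrite edge_of_rev Defs.revK.
Qed.

Lemma dual_connectC s : symmetric (dconn s).
Proof. exact/sym_connect_sym/dual_adj_sym. Qed.

Lemma dual_connected_sub s s' a b :
  s \subset s' -> dconn s a b -> dconn s' a b.
Proof.
move=> /subsetP ss'; apply: connect_sub => {}a {}b /dual_adjP[d [<- <- ds]].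
by apply/connect1/dual_adjP; exists d; split=> //; apply: ss'.
Qed.

Lemma dual_connected_edge s d :
  edge_of d \in s -> dconn s (face d) (face (rev d)).
Proof. by move=> ds; apply/connect1/dual_adjP; exists d. Qed.

(* The faces that [r] connects to [face d] are bounded by closed walks of [G],
   which leave a set of vertices as often as they enter it; if the edge of [d]
   were the only way out of the component of [src d], these walks would leave
   that component once more than they enter it. *)
Lemma deleted_connect_of_dual r d :
    ~~ dconn r (face d) (face (rev d)) ->
  connect (deleted_adj (edge_of d |: r)) (src d) (tgt d).
Proof.
move=> ndd; apply: contraT => nst.
pose A d' := dconn r (face d) (face d').
pose B x := connect (deleted_adj (edge_of d |: r)) (src d) x.
pose out := [set d' | [&& A d', B (src d') & ~~ B (tgt d')]].
pose into := [set d' | [&& A d', ~~ B (src d') & B (tgt d')]].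
have balance : #|out| = #|into|.
  pose S := [set d' | A d' && B (src d')].
  pose T := [set d' | A d' && B (tgt d')].
  (* The face permutation preserves [A] and turns targets into sources, so [T] is the preimage of
     [S]. *)
  have ST : #|S| = #|T|.
    rewrite -(card_preimset S (@perm_inj _ (face_perm (rot emb)))).
    by apply: eq_card => d'; rewrite !inE src_face_perm /A face_of_face_perm.
  have -> : out = S :\: T.
    apply/setP=> d'; rewrite !inE.
    by case: (A d'); case: (B (tgt d')); rewrite ?andbF ?andbT.
  have -> : into = T :\: S.
    apply/setP=> d'; rewrite !inE.
    by case: (A d'); case: (B (src d')); rewrite ?andbF ?andbT.
  by have := cardsID T S; have := cardsID S T; rewrite setIC ST; lia.
(* Apart from [d] and [rev d], a dart crossing the boundary of [B] has its edge in [r], so [r] also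
   connects the face on its other side. *)
have crossing d' : A d' -> B (src d') != B (tgt d') -> d' <> d -> d' <> rev d ->
    A (rev d').
  move=> Ad' Bd' dd' rdd'; have [dr|dr] := boolP (edge_of d' \in r).
    exact: connect_trans Ad' (dual_connected_edge dr).
  case/negP: Bd'; apply/eqP/(same_connect_r (deleted_connectC _))/connect1.
  apply/deleted_adjP; exists d'; split=> //; rewrite !inE (negPf dr) orbF.
  by apply/eqP => /esym/edge_of_eq[].
have Bs : B (src d) by apply: connect0.
have dout : d \in out by rewrite inE Bs nst /A /dual_connected connect0.
(* Reversal pairs the inward darts with the outward ones except [d], because [rev d] fails [A]; this
   contradicts [balance]. *)
have : #|into| = #|out :\ d|.
  rewrite -(card_preimset (out :\ d) (inv_inj (@Defs.revK G))).
  apply: eq_card => d'.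
  rewrite !inE -[src (rev d')]/(tgt d') -[tgt (rev d')]/(src d').
  have [drd'|drd'] := eqVneq (rev d') d.
    apply/negP=> /and3P[Ad' _ _]; move: Ad'; rewrite -[d']Defs.revK drd' /A.
    by rewrite (negPf ndd).
  rewrite andbA [A d' && _]andbC [A _ && _]andbC -!andbA.
  case Bt: (B (tgt d')); case Bs': (B (src d')); rewrite ?andbF //= ?andbT.
  have [d'd|d'd] := eqVneq d' d; first by rewrite d'd Bs in Bs'.
  have rd'd : d' <> rev d by move=> e; rewrite e Defs.revK eqxx in drd'.
  have rd'rd : rev d' <> rev d.
    by move=> /(inv_inj (@Defs.revK G))/eqP; apply/negP.
  apply/idP/idP => [Ad'|Ard'].
    by apply: crossing => //; [rewrite Bt Bs'|exact/eqP].
  rewrite -[d']Defs.revK; apply: crossing => //; last exact/eqP.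
  by change (B (tgt d') != B (src d')); rewrite Bt Bs'.
by rewrite -balance (cardsD1 d out) dout; lia.
Qed.

(** * Duality of cuts and cycles from Euler's formula *)

Hypothesis G_conn : connected_graph G.

(** Consecutive darts in the rotation at a vertex lie on the two sides of one edge, so the faces
    around a vertex are linked; connectedness of [G] carries this from vertex to vertex. *)
Lemma dual_connected_setT a b : dconn [set: edge G] a b.
Proof.
case: a b => [A FA] [B FB].
have [d0|d0] := eqVneq #|{: dart G}| 0.
  apply/eq_connect0/val_inj => /=; move: (FA) (FB).
  by rewrite /faces d0 eqxx => /set1P-> /set1P->.
have face_surj F (FF : F \in faces (rot emb)) :
    exists d, exist (fun F => F \in faces (rot emb)) F FF = face d.
  have := FF; rewrite {1}/faces (negPf d0) => /imsetP[d _ defF].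
  by exists d; apply: val_inj.
have [a ->] := face_surj A FA; have [b ->] := face_surj B FB.
pose D d := dconn [set: edge G] (face a) (face d).
have Drev d : D d -> D (rev d).
  by move=> Dd; apply: connect_trans Dd (dual_connected_edge _); rewrite inE.
have Drot d : D d -> D (rot emb d) by rewrite /D face_of_rot => /Drev.
have Dsrc d d' : src d' = src d -> D d -> D d'.
  move=> /eqP; rewrite -(rotP emb) => /porbitP[n ->] Dd.
  by elim: n => [|n IHn]; rewrite ?expg0 ?perm1 // expgSr permM; apply: Drot.
have [d /eqP db Dd] : exists2 d, src d == src b & D d.
  pose P x := exists2 d, src d == x & D d.
  apply: (connect_homo (P := P) _ (G_conn (src a) (src b))); last first.
    by exists a; rewrite // /D /dual_connected connect0.
  move=> x y xy [d /eqP dx Dd]; pose c : dart G := exist _ (x, y) xy.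
  by exists (rev c) => //; apply/Drev/(Dsrc d).
exact: Dsrc (esym db) Dd.
Qed.

(** Up to the constant [#|faces (rot emb)|], this is the nullity of [r] in the dual plus the rank of
    [G - r], a sum that matroid duality makes constant. The subtraction is never truncated. *)
Let potential r :=
  #|roots (dadj r)| + #|r| + (#|G| - #|roots (deleted_adj r)|).

(** The new edge adds one to [#|r|]. The dual loses a component only if the ends of the dual edge
    were not connected, and the rank of [G - r] drops only if the ends of the edge become
    disconnected; [deleted_connect_of_dual] excludes that both happen. *)
Lemma potential_step r d :
    edge_of d \notin r ->
  potential r +
    (dconn r (face d) (face (rev d)) &&
     connect (deleted_adj (edge_of d |: r)) (src d) (tgt d))
  <= potential (edge_of d |: r).
Proof.
move=> dr; set r' := edge_of d |: r.
have dual_le : #|roots (dadj r)| <=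
    #|roots (dadj r')| + ~~ dconn r (face d) (face (rev d)).
  apply: roots_add_edge; try exact: dual_adj_sym.
  move=> a b /dual_adjP[d' [<- <-]]; rewrite !inE => /orP[/eqP/esym|d'r].
    case/edge_of_eq=> ->; first by constructor 2.
    by rewrite Defs.revK; constructor 3.
  by constructor 1; apply: dual_connected_edge.
have primal_le : #|roots (deleted_adj r')| <=
    #|roots (deleted_adj r)| + ~~ connect (deleted_adj r') (src d) (tgt d).
  apply: roots_add_edge; try exact: deleted_adj_sym.
  move=> x y /deleted_adjP[d' [<- <- d'r]].
  have [/esym/edge_of_eq[]->|d'd] := eqVneq (edge_of d') (edge_of d).
  - by constructor 2.
  - by constructor 3.
  constructor 1; apply/connect1/deleted_adjP; exists d'.
  by rewrite !inE negb_or d'd.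
have := @deleted_connect_of_dual r d; rewrite -/r'.
rewrite /potential cardsU1 dr; move: dual_le primal_le.
have := max_card (roots (deleted_adj r)).
have := max_card (roots (deleted_adj r')).
case: (dconn _ _ _); case: (connect _ _ _) => /=; lia.
Qed.

Lemma potential_mono r r' : r \subset r' -> potential r <= potential r'.
Proof.
move: {2}#|r' :\: r| (leqnn #|r' :\: r|) => n; elim: n r => [|n IHn] r.
  rewrite leqn0 cards_eq0 setD_eq0 => r'r rr'.
  by have -> : r = r' by apply/eqP; rewrite eqEsubset rr'.
have [r'r _ rr'|/subsetPn[e er' er] rn rr'] := boolP (r' \subset r).
  by have -> : r = r' by apply/eqP; rewrite eqEsubset rr'.
have [d ed] := edge_of_surj e; rewrite ed in er er'.
have := potential_step er; have := IHn (edge_of d |: r).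
rewrite subUset sub1set er' rr' => /(_ _ isT); set t := nat_of_bool _.
suff -> : #|r' :\: (edge_of d |: r)| <= n.
  move=> /(_ isT) IH step; apply: leq_trans IH.
  by apply: leq_trans (leq_addr _ _) step.
have := cardsD1 (edge_of d) (r' :\: r); rewrite setDDl [r :|: _]setUC.
by rewrite !inE er er' => E; move: rn; rewrite E ltnS.
Qed.

(** Without edges the dual has one component per face, while [G] has at most one component, which
    accounts for the successor. *)
Lemma potential0 : #|faces (rot emb)| + #|G| <= (potential set0).+1.
Proof.
rewrite /potential cards0 addn0 card_roots_discrete => [|a b]; last first.
  by apply/dual_adjP => -[d' []]; rewrite inE.
have -> : #|{: dual_vertex emb}| = #|faces (rot emb)|.
  by rewrite card_sig; apply: eq_card.
rewrite -addnS leq_add2l.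
have : #|roots (deleted_adj (set0 : subgraph G))| <= 1.
  apply: card_roots_connected => x y.
  apply: connect_sub (G_conn x y) => {}x {}y xy; apply/connect1/deleted_adjP.
  by exists (exist _ (x, y) xy); rewrite inE.
by move: #|_| #|_| => k l; lia.
Qed.

(** Here the dual is connected and [G] has lost all its edges, so the rank term vanishes. *)
Lemma potentialT : potential [set: edge G] <= #|{: edge G}|.+1.
Proof.
rewrite /potential cardsT [X in _ - X]card_roots_discrete => [|x y]; last first.
  by apply/deleted_adjP=> -[d' []]; rewrite inE.
rewrite subnn addn0 -add1n leq_add2r.
exact/card_roots_connected/dual_connected_setT.
Qed.

(* By Euler's formula the potential has the same value at the empty and at the
   full subgraph, so no step in between can be strict. *)
Lemma deleted_connect_dualN r d :
    edge_of d \notin r ->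
    connect (deleted_adj (edge_of d |: r)) (src d) (tgt d) ->
  ~~ dconn r (face d) (face (rev d)).
Proof.
move=> dr cd; apply/negP=> dd; have := potential_step dr; rewrite cd dd /=.
have := potential_mono (sub0set r).
have := potential_mono (subsetT (edge_of d |: r)).
have := potential0; have := potentialT; have := euler emb.
by do 4!move: (potential _) => ?; lia.
Qed.

(** * Connectivity along the boundary of one dual face, the star of [v] *)

Definition star (v : G) : subgraph G := [set e | on_dual_face v e].

Lemma in_star v d : (edge_of d \in star v) = (v == src d) || (v == tgt d).
Proof. by rewrite inE /on_dual_face in_edge_of. Qed.

Lemma star_dual_connected d0 d :
  src d = src d0 ->
  dconn (star (src d0) :\ edge_of d0) (face (rot emb d0)) (face d).
Proof.
have rotv d' : src (rot emb d') = src d'.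
  by apply/eqP; rewrite -(rotP emb) (mem_porbit _ 1).
move=> dd0.
have /porbitP[n ->] : d \in porbit (rot emb) (rot emb d0).
  by rewrite (rotP emb) rotv dd0.
elim: n => [|n IHn]; first by rewrite expg0 perm1 /dual_connected connect0.
rewrite expgSr permM; set d' := fun_of_perm _ (rot emb d0) in IHn *.
have d'v : src d' = src d0.
  by apply/eqP; rewrite -(rotv d0) -(rotP emb) mem_porbit.
(* Back at [d0], the next corner is the starting one, so the edge of [d0] is never crossed. *)
have [->|d'd0] := eqVneq d' d0; first exact: connect0.
rewrite (face_of_rot d'); apply: connect_trans IHn (dual_connected_edge _).
rewrite !inE -/(star _) /on_dual_face in_edge_of d'v eqxx andbT.
by apply: contra d'd0 => /eqP/esym/edge_of_src_inj ->.
Qed.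

(* The edges of [t] form a forest on the components of [r]. *)
Lemma dual_connected_forest (r0 r t : subgraph G) a b :
    r0 \subset r ->
    (forall d (t' : subgraph G), edge_of d \in t -> t' \subset t :\ edge_of d ->
       ~~ dconn (r :|: t') (face d) (face (rev d))) ->
  dconn (r0 :|: t) a b -> dconn r a b -> dconn r0 a b.
Proof.
move=> r0r; move: {2}#|t| (erefl #|t|) => n; elim: n t => [|n IHn] t.
  by move=> /eqP; rewrite cards_eq0 => /eqP-> _; rewrite setU0.
move=> tn acyc abt abr.
have /card_gt0P[e et] : 0 < #|t| by rewrite tn.
have [d ed] := edge_of_surj e; rewrite ed in et.
(* Allowing every [t'] lets the hypothesis pass to the smaller set. *)
have {acyc}[acyc nd] : (forall d' (t' : subgraph G),
       edge_of d' \in t :\ edge_of d ->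
       t' \subset (t :\ edge_of d) :\ edge_of d' ->
       ~~ dconn (r :|: t') (face d') (face (rev d'))) /\
    ~~ dconn (r :|: t :\ edge_of d) (face d) (face (rev d)).
  split=> [d' t' d't t't|]; last exact: acyc.
  apply: acyc; first by case/setD1P: d't.
  by apply: subset_trans t't _; apply: setSD; apply: subsetDl.
have sub : r0 :|: t :\ edge_of d \subset r :|: t :\ edge_of d by apply: setSU.
have ab : dconn (r :|: t :\ edge_of d) a b.
  exact: dual_connected_sub (subsetUl _ _) abr.
(* A path that needs the edge of [d] would, with the connection of [a] and [b] in [r], join the ends
   of that dual edge without using it, against [nd]. *)
have := @connect_add_edge _ (dadj (r0 :|: t :\ edge_of d)) (dadj (r0 :|: t))
  (face d) (face (rev d)) (dual_adj_sym _) _ a b abt.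
case=> [a' b' /dual_adjP[d' [<- <- d't]]|abt'|[ad rdb]|[ard db]].
- have [/esym/edge_of_eq[]->|d'd] := eqVneq (edge_of d') (edge_of d).
  + by constructor 2.
  + by rewrite Defs.revK; constructor 3.
  constructor 1; apply: dual_connected_edge.
  by move: d't; rewrite !inE (negPf d'd).
- apply: (IHn (t :\ edge_of d)) => //.
  by apply/eqP; rewrite -eqSS -tn (cardsD1 (edge_of d) t) et.
- case/negP: nd; apply: connect_trans (dual_connected_sub sub _) _.
    by rewrite dual_connectC; apply: ad.
  apply: connect_trans ab (dual_connected_sub sub _).
  by rewrite dual_connectC; apply: rdb.
- case/negP: nd; rewrite dual_connectC.
  apply: connect_trans (dual_connected_sub sub _) _.
    by rewrite dual_connectC; apply: ard.
  apply: connect_trans ab (dual_connected_sub sub _).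
  by rewrite dual_connectC; apply: db.
Qed.

(* With [v := src d0], the edges at [v] outside [r], except that of [d0], are a
   forest on the components of [r], since each lies with the edge of [d0] on a
   cycle of [G - r]; and walking around [v] without crossing the edge of [d0]
   still meets every face at [v]. *)
Lemma dual_connected_star r d0 a b :
    edge_of d0 \notin r ->
    (forall d, src d = src d0 -> edge_of d \notin r ->
       connect (deleted_adj (r :|: star (src d0))) (tgt d0) (tgt d)) ->
    vertex_on_dual_face (src d0) a -> vertex_on_dual_face (src d0) b ->
  dconn r a b -> dconn (r :&: star (src d0)) a b.
Proof.
set v := src d0 => d0r conn av bv abr.
pose t := (star v :\: r) :\ edge_of d0.
refine (@dual_connected_forest (r :&: star v) r t a b (subsetIl _ _) _ _ abr).
  move=> d t' dt t't.
  have [d1 [d1v d1d ->]] : exists d1, [/\ src d1 = v, edge_of d1 = edge_of d &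
      dconn (r :|: t') (face d) (face (rev d)) =
      dconn (r :|: t') (face d1) (face (rev d1))].
    have : edge_of d \in star v by case/setD1P: dt => _ /setDP[].
    rewrite in_star => /orP[/eqP|/eqP] vd; first by exists d.
    by exists (rev d); rewrite edge_of_rev Defs.revK dual_connectC.
  rewrite -d1d in dt t't.
  have /setD1P[d10 /setDP[d1star d1r]] := dt.
  (* By duality it suffices to get from [v] to [tgt d1] without the edge of [d1]: along [d0], then
     outside the star of [v]. *)
  apply: deleted_connect_dualN.
    rewrite inE negb_or d1r; apply/negP=> /(subsetP t't).
    by rewrite !inE eqxx.
  rewrite d1v; apply: (@connect_trans _ _ (tgt d0)).
    apply/connect1/deleted_adjP; exists d0; split=> //.
    rewrite !inE negb_or eq_sym d10 negb_or d0r /=.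
    by apply/negP=> /(subsetP t't); rewrite !inE eqxx andbF.
  apply: deleted_connect_sub (conn _ d1v d1r).
  rewrite subUset sub1set inE d1star orbT /= setUS //.
  apply: subset_trans t't _; apply: subset_trans (subsetDl _ _) _.
  by apply: subset_trans (subsetDl _ _) (subsetDl _ _).
have -> : r :&: star v :|: t = star v :\ edge_of d0.
  apply/setP=> e; rewrite !inE; have [->|] := eqVneq e (edge_of d0).
    by rewrite (negPf d0r).
  by case: (e \in r); rewrite ?orbF.
case/existsP: av => da /andP[/eqP dav /eqP <-].
case/existsP: bv => db /andP[/eqP dbv /eqP <-].
apply: connect_trans (star_dual_connected dbv).
by have := star_dual_connected dav; rewrite dual_connectC.
Qed.

Lemma bridgeE s d :
  bridge emb s (edge_of d) =
  (edge_of d \in s) && ~~ dconn (s :\ edge_of d) (face d) (face (rev d)).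
Proof.
rewrite /bridge; congr (_ && _); apply/existsP/idP; last first.
  move=> nd; exists (face d); apply/existsP; exists (face (rev d)).
  by rewrite dual_ends_edge_of eqxx.
case=> a /existsP[b /andP[ends]]; apply: contra => dd.
have : dadj [set edge_of d] a b.
  by apply/existsP; exists (edge_of d); rewrite set11.
case/dual_adjP=> d' [<- <- /set1P/esym/edge_of_eq[]->] //.
by rewrite Defs.revK dual_connectC.
Qed.

End Dual.

(** * Cutsets and payoffs of strategy profiles *)

Section Game.
Variables (G : sgraph) (m : nat).
Implicit Types (u : profile G m) (d : dart G) (s : subgraph G) (v x y : G).

Lemma pblock_Phi_profile u x y :
  (y \in pblock (Phi_profile u) x) = (u x == u y).
Proof.
rewrite /Phi_profile /preim_partition pblock_equivalence_partition ?inE //.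
by split=> //= /eqP->.
Qed.

Lemma Phi_profile_partition u : partition (Phi_profile u) [set: G].
Proof. exact: preim_partitionP. Qed.

Lemma in_Psi_Phi_profile u d :
  (edge_of d \in Psi (Phi_profile u)) = (u (src d) != u (tgt d)).
Proof.
have blockE x y : (pblock (Phi_profile u) x == pblock (Phi_profile u) y) =
    (u x == u y).
  have [/eqP cov triv _] := and3P (Phi_profile_partition u).
  by rewrite eq_pblock ?cov ?inE // pblock_Phi_profile.
rewrite inE; apply/existsP/idP => [[x /andP[xd /existsP[y /andP[yd]]]]|ust].
  rewrite blockE; move: xd yd; rewrite !in_edge_of.
  by move=> /orP[]/eqP-> /orP[]/eqP->; rewrite ?eqxx // eq_sym.
exists (src d); rewrite in_edge_of eqxx; apply/existsP; exists (tgt d).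
by rewrite in_edge_of eqxx orbT blockE.
Qed.

Lemma deleted_connect_Psi u x y :
  connect (deleted_adj (Psi (Phi_profile u))) x y -> u x = u y.
Proof.
move=> xy; apply: (connect_homo (P := fun y => u x = u y) _ xy) => // {xy}.
move=> {}y z /deleted_adjP[d [<- <-]].
by rewrite in_Psi_Phi_profile negbK => /eqP <-.
Qed.

(** Deleting the cutset keeps exactly the edges inside the parts, so the parts are connected iff
    they are the components of what remains. *)
Lemma in_QCP u :
  reflect
    (forall x y, u x = u y -> connect (deleted_adj (Psi (Phi_profile u))) x y)
    (Phi_profile u \in QC G).
Proof.
have part := Phi_profile_partition u; have [/eqP cov triv _] := and3P part.
rewrite !inE part /=; apply: (iffP forallP) => [conn x y xy|conn A].
  have := conn (pblock (Phi_profile u) x).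
  rewrite pblock_mem ?cov ?inE //= => /forall_inP/(_ x).
  rewrite pblock_Phi_profile => /(_ (eqxx _))/forall_inP/(_ y).
  rewrite pblock_Phi_profile xy => /(_ (eqxx _)).
  apply: connect_sub => a b /and3P[]; rewrite !pblock_Phi_profile.
  move=> /eqP ya /eqP yb ab; apply/connect1/deleted_adjP.
  exists (exist _ (a, b) ab : dart G); split=> //.
  by rewrite in_Psi_Phi_profile negbK -[u (src _)]/(u a) -ya yb.
apply/implyP=> AP.
have inA x y : x \in A -> (y \in A) = (u x == u y).
  by move=> xA; rewrite -pblock_Phi_profile (def_pblock triv AP xA).
apply/forall_inP=> x xA; apply/forall_inP=> y; rewrite (inA x) //.
move=> /eqP/conn xy.
pose e := [rel a b | [&& a \in A, b \in A & adj a b]].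
suff [] : y \in A /\ connect e x y by [].
apply: (connect_homo (P := fun y => y \in A /\ connect e x y) _ xy) => //.
move=> a b /deleted_adjP[d [<- <-]]; rewrite in_Psi_Phi_profile negbK.
move=> ud [sA xs]; have tA : tgt d \in A by rewrite (inA _ _ sA).
by split=> //; apply/(connect_trans xs)/connect1; rewrite /= sA tA (valP d).
Qed.

(** The darts from [v] to a vertex of the same strategy are in bijection with these vertices through
    [tgt], and with the uncut edges at [v] through [edge_of]. *)
Lemma payoff_eq_card u v :
  payoff u v (u v) = #|star v :\: Psi (Phi_profile u)|.
Proof.
pose D := [set d | (src d == v) && (u v == u (tgt d))].
have srcD d : d \in D -> src d = v by rewrite inE => /andP[/eqP].
have -> : star v :\: Psi (Phi_profile u) = @edge_of G @: D.
  apply/setP=> e; have [d ->] := edge_of_surj e; apply/idP/imsetP.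
    rewrite inE in_star in_Psi_Phi_profile negbK => /andP[/eqP ud].
    case/orP=> /eqP vd; [exists d|exists (rev d)]; rewrite ?edge_of_rev //.
      by rewrite inE vd ud !eqxx.
    by rewrite inE -[src (rev d)]/(tgt d) -[tgt (rev d)]/(src d) vd ud !eqxx.
  case=> d'; rewrite [d' \in _]inE => /andP[/eqP sv /eqP uv] ->.
  by rewrite in_setD in_star in_Psi_Phi_profile sv uv !eqxx.
rewrite card_in_imset; last first.
  move=> d d' /srcD dv /srcD d'v /edge_of_src_inj.
  by rewrite dv d'v => ->.
rewrite -(@card_in_imset _ _ (@tgt G)); last first.
  move=> d d' /srcD dv /srcD d'v.
  by apply: dart_inj; rewrite dv d'v.
rewrite -sum1_card [RHS]big_mkcond /payoff; apply: eq_bigr => x _.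
rewrite /W; case: ifP => [/imsetP[d]|/negP xD].
  rewrite inE => /andP[/eqP <- uv] ->; rewrite uv muln1.
  by rewrite -[adj _ _]/(adj (val d).1 (val d).2) (valP d).
have [vx|//] := boolP (adj v x); have [uvx|//] := eqVneq (u v) (u x).
case: xD; apply/imsetP; exists (exist _ (v, x) vx : dart G) => //.
by rewrite inE eqxx /= uvx.
Qed.

Definition deviate u v i : profile G m := [ffun x => if x == v then i else u x].

Lemma deviate_same u v i : deviate u v i v = i.
Proof. by rewrite ffunE eqxx. Qed.

Lemma deviate_neq u v i x : x != v -> deviate u v i x = u x.
Proof. by rewrite ffunE => /negPf->. Qed.

(** The sum does not see the strategy of [v], which is not its own neighbour. *)
Lemma payoff_deviate u v i : payoff (deviate u v i) v i = payoff u v i.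
Proof.
apply: eq_bigr => x _; have [->|xv] := eqVneq x v; first by rewrite /W adj_irr.
by rewrite deviate_neq.
Qed.

Lemma Psi_deviate_locality u v i e :
  ~~ on_dual_face v e ->
  (e \in Psi (Phi_profile (deviate u v i))) = (e \in Psi (Phi_profile u)).
Proof.
have [d ->] := edge_of_surj e; rewrite /on_dual_face in_edge_of negb_or.
by rewrite !in_Psi_Phi_profile => /andP[vs vt]; rewrite !deviate_neq // eq_sym.
Qed.

(** The cut size is a potential of the game: only edges at [v] change status, and the payoff of [v]
    counts the uncut ones before and after. *)
Lemma card_Psi_deviate u v i :
  #|Psi (Phi_profile (deviate u v i))| + payoff u v i =
  #|Psi (Phi_profile u)| + payoff u v (u v).
Proof.
rewrite -payoff_deviate -[X in _ + payoff _ _ X = _](deviate_same u v i).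
rewrite !payoff_eq_card.
apply: cardsD_exchange; apply/setP=> e; rewrite in_setD [RHS]in_setD.
have [//|/=] := boolP (e \in star v); rewrite inE => ev.
exact: Psi_deviate_locality.
Qed.

End Game.

(** * Deviations as single face rewirings *)

Section Rewiring.
Variables (G : sgraph) (emb : plane_embedding G) (m : nat).
Hypothesis G_conn : connected_graph G.
Implicit Types (u : profile G m) (s : subgraph G) (v x y : G).

(** If a cut edge were a bridge, duality would join its ends in [G] minus the cutset, hence inside
    one part, so the edge would not be cut. *)
Lemma Psi_SC u : Psi (Phi_profile u) \in SC emb.
Proof.
rewrite inE; apply/forallP=> e; have [d ->] := edge_of_surj e.
rewrite bridgeE; apply/negP=> /andP[ds].
move=> /deleted_connect_of_dual; rewrite setD1K // => /deleted_connect_Psi ud.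
by rewrite in_Psi_Phi_profile ud eqxx in ds.
Qed.

Lemma SFR_deviate u v i :
    Phi_profile u \in QC G -> 0 < payoff u v i -> u v != i ->
  SFR emb (Psi (Phi_profile u)) (Psi (Phi_profile (deviate u v i))).
Proof.
move=> /in_QCP uQC pos uvi; rewrite /SFR /= !Psi_SC; apply/existsP; exists v.
apply/andP; split.
  apply/forallP=> e; apply/implyP=> ev.
  by rewrite (Psi_deviate_locality u i ev).
set r := Psi (Phi_profile (deviate u v i)).
(* A positive payoff gives [v] a neighbour using [i]; the edge to it is uncut after the move. *)
have [d0 d0v d0r] : exists2 d0, src d0 = v & edge_of d0 \notin r.
  move: pos; rewrite -payoff_deviate -{2}(deviate_same u v i) payoff_eq_card.
  case/card_gt0P=> e; have [d ->] := edge_of_surj e.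
  rewrite inE in_star => /andP[dr /orP[]/eqP vd]; first by exists d.
  by exists (rev d); rewrite ?edge_of_rev.
have u_tgt d : src d = v -> edge_of d \notin r -> u (tgt d) = i.
  move=> dv; rewrite in_Psi_Phi_profile negbK dv deviate_same => /eqP ->.
  by rewrite deviate_neq // -dv eq_sym src_neq_tgt.
(* Connectivity in contrapositive form: corners of [v] that are connected in [r] are already
   connected along [v]. *)
apply/forallP=> a; apply/forallP=> b; apply/implyP.
case/and4P=> /andP[av _] /andP[bv _] _; apply: contra => rab.
have -> : connected_along v r a b = dual_connected (r :&: star v) a b.
  rewrite /connected_along; congr (dual_connected _ a b).
  by apply/setP=> e; rewrite !inE.
rewrite -d0v in av bv *; apply: dual_connected_star => // d; rewrite d0v.
move=> dv dr.
(* The part of strategy [i] avoids [v] and is connected in [G]. *)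
have := uQC (tgt d0) (tgt d); rewrite !u_tgt // => /(_ erefl) conn.
pose P x := u x = i /\ connect (deleted_adj (r :|: star v)) (tgt d0) x.
suff [] : P (tgt d) by [].
apply: (connect_homo (P := P) _ conn); last by split; [apply: u_tgt|].
move=> x y /deleted_adjP[c [<- <- cs]] [uc d0c].
have ucE : u (src c) = u (tgt c).
  by apply/eqP; move: cs; rewrite in_Psi_Phi_profile negbK.
have neq x' : u x' = i -> v != x'.
  by move=> ux'; apply: contraNneq uvi => ->; apply/eqP.
split; first by rewrite -ucE.
have cv : edge_of c \notin star v by rewrite in_star negb_or !neq // -ucE.
apply: connect_trans d0c (connect1 _); apply/deleted_adjP; exists c; split=> //.
rewrite inE negb_or cv andbT (Psi_deviate_locality u i) //.
by rewrite inE in cv.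
Qed.

End Rewiring.

(** * From size-minimal subgraphs to equilibria *)

Theorem theorem3p1 (G : sgraph) (G_conn : connected_graph G)
    (emb : plane_embedding G) (m : nat) (m_ge : #|G| <= m)
    (s : subgraph G) (s_SC : s \in SC emb)
    (s_min : forall r : subgraph G, r \in GammaSC emb s ->
       size_sg s <= size_sg r) :
  exists u : profile_class G m,
    [/\ Psi (Phi u) = s,
        nash_class u,
        Phi u \in QC G
      & forall u' : profile_class G m,
          Phi u' \in QC G -> Psi (Phi u') = s -> u' = u].
Proof.
have conn_equiv : {in [set: G] & &, equivalence_rel (connect (deleted_adj s))}.
  move=> x y z _ _ _; split; first exact: connect0.
  by move/(same_connect (deleted_connectC s))->.
have components_QG :
    equivalence_partition (connect (deleted_adj s)) [set: G] \in QG G.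
  by rewrite inE; apply: equivalence_partitionP.
have [a Phi_a] := Phi_surj m_ge components_QG.
have aE x y : (repr a x == repr a y) = connect (deleted_adj s) x y.
  by rewrite -pblock_Phi_profile [Phi_profile _]Phi_a
             pblock_equivalence_partition ?inE.
(* An edge outside [s] stays within a component. If the ends of an edge of [s] were in one component
   of [G - s], its dual would be a bridge. *)
have Psi_a : Psi (Phi a) = s.
  apply/setP=> e; have [d ->] := edge_of_surj e.
  rewrite in_Psi_Phi_profile aE; apply/idP/idP => [|ds].
    by apply: contraR => ds; apply/connect1/deleted_adjP; exists d.
  move: s_SC; rewrite inE => /forallP/(_ (edge_of d)); rewrite bridgeE ds /=.
  apply: contraNN => st; apply: deleted_connect_dualN; rewrite ?setD1K //.
  by rewrite !inE eqxx.
have a_QC : Phi a \in QC G.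
  by apply/in_QCP => x y /eqP; rewrite aE -[Psi _]/(Psi (Phi a)) Psi_a.
exists a; split=> //.
  rewrite -[a]reprK nash_class_pi; apply/forallP=> v; apply/forallP=> i.
  rewrite leqNgt; apply/negP=> gain.
  (* A strict gain makes the new payoff positive and [i] different from the current strategy, as the
     rewiring requires. *)
  have rSFR : SFR emb s (Psi (Phi_profile (deviate (repr a) v i))).
    rewrite -Psi_a; apply: SFR_deviate => //; first exact: leq_ltn_trans gain.
    by apply: contraTneq gain => <-; rewrite ltnn.
  have := s_min (Psi (Phi_profile (deviate (repr a) v i))).
  rewrite in_GammaSC // rSFR orbT => /(_ isT); rewrite /size_sg.
  have := card_Psi_deviate (repr a) v i.
  rewrite -[Phi_profile (repr a)]/(Phi a) Psi_a.
  by move: gain; move: #|_| #|_| (payoff _ _ _) (payoff _ _ _) => p q k l; lia.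
(* Connected parts with cutset [s] must be the components of [G - s], so the partition is
   determined. *)
move=> b /in_QCP bQC Psi_b; apply/Phi_inj/eq_in_imset => x _.
apply/setP=> y; rewrite !inE aE; apply/eqP/idP => [/bQC|].
  by rewrite -[Psi _]/(Psi (Phi b)) Psi_b.
by rewrite -Psi_b; apply: deleted_connect_Psi.
Qed.
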